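(* Let $D$ be a flat $S$-derivation on a neighborhood $U$ in a differentiable manifold $M$, and suppose there exist bases of vector fields on $U$ in which the components of $D$ along every vector field vanish on $U$. Then all such bases are holonomic in $U$ if and only if $D$ has zero torsion in $U$ ($T^D=0$ on $U$), and all such bases are anholonomic in $U$ if and only if $D$ has nonzero torsion in $U$ ($T^D$ is not identically zero on $U$).
   Context: $n=\dim M$; latin indices run from $1$ to $n$ and repeated indices on different levels are summed. Manifold, fields and frames are assumed differentiable as many times as the expressions below require (e.g. smooth). Everything is local: a neighborhood $U$ means a coordinate neighborhood of a point, small enough to be identified with an open ball in $\mathbb{R}^n$. $S$-derivation: let $S:X\mapsto S_X$ be a map (no linearity is assumed) from $C^1$ vector fields to tensor fields of type $(1,1)$. For each $X$ the formula $D_X=L_X+S_X$ defines a derivation of the tensor algebra, where $L_X$ is the Lie derivative along $X$ and $S_X$ acts as the algebraic derivation induced by the endomorphism field $S_X$ (so $S_X f=0$ on functions and $S_X Y=S_X(Y)$ on vector fields). The map $D:X\mapsto D_X$ is called an $S$-derivation. Components: in a local basis (frame) $\{E_i\}$ of vector fields, the components of $D_X$ are the functions $(W_X)^i_{.j}$ defined by $D_X(E_j)=(W_X)^i_{.j}E_i$. Curvature and torsion: $R^D(X,Y)=D_XD_Y-D_YD_X-D_{[X,Y]}$ and $T^D(X,Y)=D_XY-D_YX-[X,Y]$. $D$ is flat if $R^D=0$ and torsion free if $T^D=0$. A basis $\{E_i\}$ on $U$ is holonomic if $[E_i,E_j]=0$ on $U$ for all $i,j$, and anholonomic otherwise. 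*)

(* Defs.v *)
From HB Require Import structures.
From mathcomp Require Import all_boot all_order all_algebra.
From mathcomp Require Import all_classical all_reals all_analysis.

Set Implicit Arguments.
Unset Strict Implicit.
Unset Printing Implicit Defensive.

Import Order.TTheory GRing.Theory Num.Theory.
Import numFieldNormedType.Exports.

Local Open Scope classical_set_scope.
Local Open Scope ring_scope.

(* A coordinate neighborhood is identified with a Euclidean open ball; the
   library's [ball] on ['rV[R]_n] is the ball of the sup norm. *)
Definition eball (R : realType) (n : nat) (c : 'rV[R]_n) (r : R) :
    set 'rV[R]_n :=
  [set x | \sum_i (x 0 i - c 0 i) ^+ 2 < r ^+ 2].

(* Fields on [U] are represented by functions on the whole of ['rV[R]_n], of
   which only the values on the open set [U] are ever used. Tangent vectors are
   row vectors, and, as usual in the library, a matrix [A] is the endomorphism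
   [v |-> v *m A]: its entry [A k i] is the component A^i_k. In particular
   [jacobian X x k i] is the k-th partial derivative of X^i. *)
Notation vfield R n := ('rV[R]_n -> 'rV[R]_n).
Notation endofield R n := ('rV[R]_n -> 'M[R]_n).

(* [K x I J] is the component of K at x of contravariant indices [I 0], ...,
   [I (p-1)] and covariant indices [J 0], ..., [J (q-1)]. *)
Definition tensor (R : realType) (n p q : nat) : Type :=
  'rV[R]_n -> {ffun 'I_p -> 'I_n} -> {ffun 'I_q -> 'I_n} -> R.

Section Fields.
Variables (R : realType) (n : nat).
Implicit Types (U : set 'rV[R]_n) (X Y : vfield R n) (A : endofield R n).

Definition C1 (V : normedModType R) U (f : 'rV[R]_n -> V) : Prop :=
  forall x, U x -> differentiable f x /\
    forall v, 'D_v f y @[y --> x] --> 'D_v f x.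

Definition tensorC1 (p q : nat) U (K : tensor R n p q) : Prop :=
  forall I J, C1 U (fun x => K x I J).

Definition lie X Y : vfield R n :=
  fun x => 'D_(X x) Y x - 'D_(Y x) X x.

Definition setidx (p : nat) (I : {ffun 'I_p -> 'I_n}) (a : 'I_p) (k : 'I_n) :
    {ffun 'I_p -> 'I_n} :=
  [ffun b => if b == a then k else I b].

(* The algebraic derivation of the tensor algebra, zero on functions, induced
   by an endomorphism field. *)
Definition algder (p q : nat) A (K : tensor R n p q) : tensor R n p q :=
  fun x I J =>
    \sum_(a < p) \sum_(k < n) A x k (I a) * K x (setidx I a k) J
    - \sum_(b < q) \sum_(k < n) A x (J b) k * K x I (setidx J b k).

(* The Lie derivative in the coordinates of ['rV[R]_n]:
   (L_X K)^I_J = X(K^I_J) - sum_{a,k} (d_k X^(I a)) K^(I[a:=k])_J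
                 + sum_{b,k} (d_(J b) X^k) K^I_(J[b:=k]). *)
Definition lieT (p q : nat) X (K : tensor R n p q) : tensor R n p q :=
  fun x I J =>
    'D_(X x) (fun y => K y I J) x
    + algder (fun y => - jacobian X y) K x I J.

(* The map S, defined on the C^1 vector fields on [U] without any linearity;
   the second field says that S_X on [U] is determined by X on [U]. *)
Record smap U := SMap {
  smap_val :> vfield R n -> endofield R n;
  smap_loc : forall X Y, C1 U X -> C1 U Y -> (forall x, U x -> X x = Y x) ->
    forall x, U x -> smap_val X x = smap_val Y x
}.

Variables (U : set 'rV[R]_n) (S : smap U).

(* D_X = L_X + S_X on vector fields, and on tensor fields of any type; the two
   agree on vector fields, see [sderT_vfield]. *)
Definition sder X Y : vfield R n := fun x => lie X Y x + Y x *m S X x.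

Definition sderT (p q : nat) X (K : tensor R n p q) : tensor R n p q :=
  fun x I J => lieT X K x I J + algder (S X) K x I J.

Definition curvature (p q : nat) X Y (K : tensor R n p q) : tensor R n p q :=
  fun x I J => sderT X (sderT Y K) x I J - sderT Y (sderT X K) x I J
               - sderT (lie X Y) K x I J.

(* The fields are required to be exactly as regular as R^D(X,Y)K needs to be
   defined. *)
Definition flat : Prop :=
  forall (p q : nat) X Y (K : tensor R n p q),
    C1 U X -> C1 U Y -> C1 U (lie X Y) ->
    tensorC1 U K -> tensorC1 U (sderT X K) -> tensorC1 U (sderT Y K) ->
    forall x I J, U x -> curvature X Y K x I J = 0.

Definition torsion X Y : vfield R n :=
  fun x => sder X Y x - sder Y X x - lie X Y x.

Definition torsion_free : Prop :=
  forall X Y, C1 U X -> C1 U Y -> forall x, U x -> torsion X Y x = 0.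

Definition frame_at (E : 'I_n -> vfield R n) (x : 'rV[R]_n) :
    n.-tuple 'rV[R]_n :=
  [tuple E i x | i < n].

Definition frame (E : 'I_n -> vfield R n) : Prop :=
  (forall i, C1 U (E i)) /\
  (forall x, U x -> basis_of fullv (frame_at E x)).

(* [components E X x i j] is (W_X)^i_j at x: D_X E_j = sum_i (W_X)^i_j E_i. *)
Definition components (E : 'I_n -> vfield R n) X : endofield R n :=
  fun x => \matrix_(i, j) coord (frame_at E x) i (sder X (E j) x).

Definition normal_frame (E : 'I_n -> vfield R n) : Prop :=
  frame E /\
  (forall X, C1 U X -> forall x, U x -> components E X x = 0).

End Fields.

Definition holonomic (R : realType) (n : nat) (U : set 'rV[R]_n)
    (E : 'I_n -> vfield R n) : Prop :=
  forall i j x, U x -> lie (E i) (E j) x = 0.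

Definition anholonomic (R : realType) (n : nat) (U : set 'rV[R]_n)
    (E : 'I_n -> vfield R n) : Prop :=
  ~ holonomic U E.

Definition vtensor (R : realType) (n : nat) (Y : vfield R n) :
    tensor R n 1 0 :=
  fun x I _ => Y x 0 (I ord0).

Lemma sderT_vfield (R : realType) (n : nat) (U : set 'rV[R]_n) (S : smap U)
    (X Y : vfield R n) (x : 'rV[R]_n)
    (I : {ffun 'I_1 -> 'I_n}) (J : {ffun 'I_0 -> 'I_n}) :
  C1 U X -> C1 U Y -> U x ->
  sderT S X (vtensor Y) x I J = vtensor (sder S X Y) x I J.
Proof.
move=> CX CY Ux; have [dX _] := CX x Ux; have [dY _] := CY x Ux.
have alg A : algder A (vtensor Y) x I J = (Y x *m A x) 0 (I ord0).
  rewrite /algder big_ord1 big_ord0 subr0 mxE; apply: eq_bigr => k _.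
  by rewrite /vtensor ffunE eqxx mulrC.
have dYX : derivable Y x (X x) by apply: diff_derivable.
rewrite /sderT /lieT !alg mulmxN -(deriveEjacobian _ dX).
by rewrite /vtensor /sder /lie (derive_mx dYX) [in RHS]mxE [in RHS]mxE !mxE.
Qed.

(* Main.v *)
Require Import Defs.
From HB Require Import structures.
From mathcomp Require Import all_boot all_order all_algebra.
From mathcomp Require Import all_classical all_reals all_analysis.

Import Order.TTheory GRing.Theory Num.Theory.
Import numFieldNormedType.Exports.

Local Open Scope classical_set_scope.
Local Open Scope ring_scope.

(** A frame [E] in which the components of [D] vanish satisfies [D_X E_j = 0]
    for every [X], which pins [S_X] down at each point: [E_j S_X = - [X, E_j]].
    Hence [D_X] is the parallelism of [E], that is
    [D_X Y = X(Y) - Y^j X(E_j)] (lemma [sder_normal_frame]), and in particular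
    [D_X Y] is linear in [X] although [S] need not be. Its torsion is then the
    tensor [T(X, Y) = - X^i Y^j [E_i, E_j]] (lemma [torsion_normal_frame]). So
    [T] vanishes as soon as one such frame is holonomic, and conversely
    [T(E_i, E_j) = - [E_i, E_j]] makes every such frame holonomic when [T] is
    zero. Whether a frame of this kind is holonomic thus depends on [D] alone,
    and both equivalences follow since such frames exist.

    The vectors [X x] and [Y x] are expanded on the basis [E x] at the single
    point [x], with constant coefficients, so the whole computation is linear
    algebra in the direction of differentiation: a directional derivative at a
    point of differentiability is linear in the direction. *)

Section NormalFrame.
Context {R : realType} {n : nat} {U : set 'rV[R]_n}.
Variable S : smap U.
Implicit Types (X Y : 'rV[R]_n -> 'rV[R]_n) (E : 'I_n -> 'rV[R]_n -> 'rV[R]_n).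

Lemma coord_frame {E x} (v : 'rV[R]_n) : frame U E -> U x ->
  v = \sum_i coord (frame_at E x) i v *: E i x.
Proof.
move=> [_ fE] Ux; rewrite {1}(coord_basis (fE x Ux) (memvf v)).
by apply: eq_bigr => i _; rewrite -tnth_nth tnth_mktuple.
Qed.

Lemma sder_normal0 {E X x} j : normal_frame S E -> C1 U X -> U x ->
  sder S X (E j) x = 0.
Proof.
move=> [fE E0] CX Ux; rewrite (coord_frame (sder S X (E j) x) fE Ux) big1// => i _.
by have /matrixP/(_ i j) := E0 X CX x Ux; rewrite !mxE => ->; rewrite scale0r.
Qed.

Lemma derive_frame {E X} {v x : 'rV[R]_n} : frame U E -> C1 U X -> U x ->
  'D_v X x = \sum_i coord (frame_at E x) i v *: 'D_(E i x) X x.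
Proof.
move=> fE CX Ux; have [dX _] := CX x Ux.
rewrite deriveE// {1}(coord_frame v fE Ux) linear_sum/=.
by apply: eq_bigr => i _; rewrite linearZ/= deriveE.
Qed.

(** The endomorphism [S X x] is known on the basis [E x], where it takes [E_j]
    to [- [X, E_j]]; the terms [D_(E_j) X] of these brackets recombine into the
    term [D_Y X] of [[X, Y]] and cancel it. *)
Lemma sder_normal_frame {E X Y x} :
  normal_frame S E -> C1 U X -> C1 U Y -> U x ->
  sder S X Y x =
    'D_(X x) Y x - \sum_j coord (frame_at E x) j (Y x) *: 'D_(X x) (E j) x.
Proof.
move=> nE CX CY Ux; have fE := nE.1.
have SE j : E j x *m S X x = - lie X (E j) x.
  by apply/eqP; rewrite -addr_eq0 addrC; apply/eqP/(sder_normal0 j nE).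
rewrite /sder {1}(coord_frame (Y x) fE Ux) mulmx_suml /lie.
rewrite (derive_frame (v := Y x) fE CX Ux) -addrA -!sumrN -big_split/=.
congr (_ + _); apply: eq_bigr => j _.
by rewrite -scalemxAl SE /lie opprB scalerBr addKr.
Qed.

Lemma torsion_normal_frame {E X Y x} :
  normal_frame S E -> C1 U X -> C1 U Y -> U x ->
  torsion S X Y x =
    - \sum_i \sum_j (coord (frame_at E x) i (X x) * coord (frame_at E x) j (Y x))
                      *: lie (E i) (E j) x.
Proof.
move=> nE CX CY Ux; have fE := nE.1.
rewrite /torsion (sder_normal_frame nE CX CY Ux) (sder_normal_frame nE CY CX Ux).
pose a i := coord (frame_at E x) i (X x).
pose b j := coord (frame_at E x) j (Y x).
have DXE : \sum_j b j *: 'D_(X x) (E j) x =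
    \sum_i \sum_j (a i * b j) *: 'D_(E i x) (E j) x.
  rewrite exchange_big; apply: eq_bigr => j _.
  rewrite (derive_frame fE (fE.1 j) Ux) scaler_sumr.
  by apply: eq_bigr => i _; rewrite scalerA mulrC.
have DYE : \sum_i a i *: 'D_(Y x) (E i) x =
    \sum_i \sum_j (a i * b j) *: 'D_(E j x) (E i) x.
  apply: eq_bigr => i _; rewrite (derive_frame fE (fE.1 i) Ux) scaler_sumr.
  by apply: eq_bigr => j _; rewrite scalerA.
have -> : \sum_i \sum_j (a i * b j) *: lie (E i) (E j) x =
    \sum_i \sum_j (a i * b j) *: 'D_(E i x) (E j) x
    - \sum_i \sum_j (a i * b j) *: 'D_(E j x) (E i) x.
  rewrite -sumrB; apply: eq_bigr => i _; rewrite -sumrB.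
  by apply: eq_bigr => j _; rewrite /lie scalerBr.
by rewrite DXE DYE /lie !opprB !addrA subrK addrC -!addrA addKr addrC.
Qed.

(** The torsion on pairs [E_i, E_j] controls the brackets, and by tensoriality
    these pairs determine the torsion on all fields. *)
Lemma torsion_free_holonomic {E} :
  normal_frame S E -> torsion_free S <-> holonomic U E.
Proof.
move=> nE; split=> [T0 i j x Ux | hE X Y CX CY x Ux].
  have := T0 _ _ (nE.1.1 i) (nE.1.1 j) x Ux.
  rewrite /torsion (sder_normal0 j nE (nE.1.1 i) Ux).
  rewrite (sder_normal0 i nE (nE.1.1 j) Ux) subrr sub0r.
  by move/eqP; rewrite oppr_eq0 => /eqP.
rewrite (torsion_normal_frame nE CX CY Ux) big1 ?oppr0// => i _.
by rewrite big1// => j _; rewrite hE// scaler0.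
Qed.

End NormalFrame.

Theorem proposition4 (R : realType) (n : nat) (c : 'rV[R]_n) (r : R)
    (r_gt0 : 0 < r) (S : smap (eball c r)) (S_flat : flat S)
    (S_normal : exists E : 'I_n -> vfield R n, normal_frame S E) :
  ((forall E : 'I_n -> vfield R n,
      normal_frame S E -> holonomic (eball c r) E)
    <-> torsion_free S) /\
  ((forall E : 'I_n -> vfield R n,
      normal_frame S E -> anholonomic (eball c r) E)
    <-> ~ torsion_free S).
Proof.
have [E0 nE0] := S_normal.
split; split.
- by move=> hol; apply/(torsion_free_holonomic S nE0)/hol.
- by move=> T0 E nE; apply/(torsion_free_holonomic S nE).
- by move=> anhol T0; apply: (anhol E0 nE0); apply/(torsion_free_holonomic S nE0).
- by move=> nT0 E nE hE; apply: nT0; apply/(torsion_free_holonomic S nE).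
Qed.
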